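(* Let $E$ be a finite set and $\Omega=E^{\mathbb{Z}}$ with left shift $S$. Let $\mu$ be a shift-invariant probability measure on $\Omega$ which is a DLR Gibbs measure (i.e. Gibbs for some Gibbsian specification on $\Omega$). Then there exists a continuous function $\phi:\Omega\to\mathbb{R}$ with the extensibility property such that $\mu$ is an equilibrium state for $\phi$.
   Context: $E$ is finite with the discrete topology, $\Omega=E^{\mathbb{Z}}$ has the product topology, $(S\omega)_i=\omega_{i+1}$. For $\omega\in\Omega$, $a\in E$, $\omega^a$ is the configuration equal to $a$ at site $0$ and to $\omega_k$ at $k\ne0$. A continuous $\phi$ has the extensibility property if for all $a,\tilde a\in E$, $\sum_{i=-n}^{n}[\phi(S^i\omega^a)-\phi(S^i\omega^{\tilde a})]$ converges uniformly in $\omega$ as $n\to\infty$. An equilibrium state for $\phi$ is a shift-invariant probability $\mu$ with $h(\mu)+\int\phi\,d\mu=P(\phi)$ (measure-theoretic entropy, topological pressure). For finite $\Lambda\subset\mathbb{Z}$, $\xi_\Lambda\omega_{\Lambda^c}$ denotes the configuration equal to $\xi$ on $\Lambda$ and $\omega$ elsewhere. A specification is a family $(\gamma_\Lambda)_{\Lambda\text{ finite}}$ of probabilities $\gamma_\Lambda(\cdot|\omega_{\Lambda^c})$ on $E^\Lambda$ depending only on $\omega_{\Lambda^c}$, consistent in the sense that with $\gamma_\Lambda(f|\omega)=\sum_{\xi_\Lambda}\gamma_\Lambda(\xi_\Lambda|\omega_{\Lambda^c})f(\xi_\Lambda\omega_{\Lambda^c})$, for finite $\Delta\subset\Lambda$: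 $\sum_{\xi_\Lambda}\gamma_\Lambda(\xi_\Lambda|\omega_{\Lambda^c})\gamma_\Delta(f|\xi_\Lambda\omega_{\Lambda^c})=\gamma_\Lambda(f|\omega)$. It is Gibbsian if non-null ($\inf_\omega\gamma_\Lambda(\omega_\Lambda|\omega_{\Lambda^c})>0$) and continuous ($\omega\mapsto\gamma_\Lambda(\omega_\Lambda|\omega_{\Lambda^c})$ continuous) for every finite $\Lambda$. $\mu$ is Gibbs for $\gamma$ if $\int\gamma_\Lambda(f|\omega)\mu(d\omega)=\int f\,d\mu$ for all $f\in C(\Omega)$ and finite $\Lambda$. *)

(* Defs.v *)
From HB Require Import structures.
From mathcomp Require Import all_boot all_order all_algebra finmap.
From mathcomp Require Import all_classical all_reals all_analysis.
Import Order.TTheory GRing.Theory Num.Theory.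
Import numFieldNormedType.Exports.
Local Open Scope ring_scope.
Local Open Scope classical_set_scope.

Definition conf (E : finType) := int -> E.

(** The carrier with a chosen point (needed by measurableType). *)
Definition confp {E : finType} (e0 : E) := conf E.
HB.instance Definition _ (E : finType) (e0 : E) := Choice.on (confp e0).
HB.instance Definition _ (E : finType) (e0 : E) :=
  isPointed.Build (confp e0) (fun _ => e0).

(** One-site cylinder sets {omega | omega_k = a}; they generate the Borel
    sigma-algebra of the product topology (E discrete, Z countable). *)
Definition cylsets {E : finType} (e0 : E) : set (set (confp e0)) :=
  [set A | exists (k : int) (a : E), A = (fun w : confp e0 => w k = a)].

Definition Omega {E : finType} (e0 : E) := g_sigma_algebraType (cylsets e0).

Definition shift {E : finType} (w : conf E) : conf E := fun k => w (k + 1).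
Definition shiftn {E : finType} (i : int) (w : conf E) : conf E :=
  fun k => w (k + i).

Definition upd {E : finType} (w : conf E) (a : E) : conf E :=
  fun k => if k == 0 then a else w k.

(** Continuity for the product topology on E^Z (E discrete): the
    neighbourhoods of w are generated by the cylinders fixing w on [-N,N]. *)
Definition cont_conf {R : realType} {E : finType} (f : conf E -> R) : Prop :=
  forall (w : conf E) (eps : R), 0 < eps ->
    exists N : nat, forall w' : conf E,
      (forall k : int, (absz k <= N)%N -> w' k = w k) -> `|f w' - f w| < eps.

Definition ext_sum {R : realType} {E : finType} (phi : conf E -> R)
  (a b : E) (n : nat) (w : conf E) : R :=
  \sum_(j < (n + n).+1)
     (phi (shiftn (j%:Z - n%:Z) (upd w a)) - phi (shiftn (j%:Z - n%:Z) (upd w b))).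

Definition extensible {R : realType} {E : finType} (phi : conf E -> R) : Prop :=
  forall a b : E, exists F : conf E -> R,
    forall eps : R, 0 < eps -> exists N : nat, forall n : nat, (N <= n)%N ->
      forall w : conf E, `|ext_sum phi a b n w - F w| < eps.

Definition cyl {E : finType} {n : nat} (a : {ffun 'I_n -> E}) : set (conf E) :=
  [set w | forall i : 'I_n, w (nat_of_ord i)%:Z = a i].

(** H_n(mu) = - sum_{|a|=n} mu[a] ln mu[a]   (with 0 ln 0 = 0). *)
Definition block_entropy {R : realType} {E : finType} {e0 : E}
  (mu : probability (Omega e0) R) (n : nat) : R :=
  - \sum_(a : {ffun 'I_n -> E})
      fine (mu (cyl a)) * ln (fine (mu (cyl a))).

(** Measure-theoretic (Kolmogorov-Sinai) entropy of a shift-invariant mu: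
    h(mu) = lim_n H_n(mu)/n. *)
Definition entropy {R : realType} {E : finType} {e0 : E}
  (mu : probability (Omega e0) R) : R :=
  limn (fun n : nat => block_entropy mu n / n%:R).

Definition birkhoff {R : realType} {E : finType} (phi : conf E -> R)
  (n : nat) (w : conf E) : R :=
  \sum_(i < n) phi (shiftn (nat_of_ord i)%:Z w).

Definition pressure {R : realType} {E : finType} (phi : conf E -> R) : R :=
  limn (fun n : nat =>
    ln (\sum_(a : {ffun 'I_n -> E}) expR (sup (birkhoff phi n @` cyl a))) / n%:R).

Definition shift_invariant {R : realType} {E : finType} {e0 : E}
  (mu : probability (Omega e0) R) : Prop :=
  forall A : set (Omega e0), measurable A ->
    mu (@shift E @^-1` A) = mu A.

Definition equilibrium_state {R : realType} {E : finType} {e0 : E}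
  (phi : conf E -> R) (mu : probability (Omega e0) R) : Prop :=
  shift_invariant mu /\
  entropy mu + fine (\int[mu]_x (phi x)%:E)%E = pressure phi.

Definition patch {E : finType} (L : {fset int}) (xi : {ffun L -> E})
  (w : conf E) : conf E :=
  fun k => if @insub _ (fun x => x \in L) L k is Some i then xi i else w k.

Definition restr {E : finType} (L : {fset int}) (w : conf E) : {ffun L -> E} :=
  [ffun i : L => w (val i)].

(** A candidate specification: gamma L w xi = gamma_L(xi_L | w_(L^c)). *)
Definition spec_type (R : realType) (E : finType) :=
  forall L : {fset int}, conf E -> {ffun L -> E} -> R.

Definition spec_int {R : realType} {E : finType} (gamma : spec_type R E)
  (L : {fset int}) (f : conf E -> R) (w : conf E) : R :=
  \sum_(xi : {ffun L -> E}) gamma L w xi * f (patch L xi w).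

Definition is_specification {R : realType} {E : finType}
  (gamma : spec_type R E) : Prop :=
  [/\ (forall (L : {fset int}) (w w' : conf E),
         (forall k, k \notin L -> w k = w' k) -> gamma L w = gamma L w'),
      (forall (L : {fset int}) (w : conf E) (xi : {ffun L -> E}), 0 <= gamma L w xi),
      (forall (L : {fset int}) (w : conf E), \sum_(xi : {ffun L -> E}) gamma L w xi = 1)
    & (forall (L D : {fset int}), fsubset D L ->
         forall (f : conf E -> R) (w : conf E),
           \sum_(xi : {ffun L -> E}) gamma L w xi * spec_int gamma D f (patch L xi w)
           = spec_int gamma L f w)].

Definition non_null {R : realType} {E : finType} (gamma : spec_type R E) : Prop :=
  forall L : {fset int}, exists c : R, 0 < c /\
    forall w : conf E, c <= gamma L w (restr L w).

Definition spec_continuous {R : realType} {E : finType}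
  (gamma : spec_type R E) : Prop :=
  forall L : {fset int}, cont_conf (fun w : conf E => gamma L w (restr L w)).

Definition gibbsian {R : realType} {E : finType} (gamma : spec_type R E) : Prop :=
  [/\ is_specification gamma, non_null gamma & spec_continuous gamma].

Definition is_gibbs_for {R : realType} {E : finType} {e0 : E}
  (gamma : spec_type R E) (mu : probability (Omega e0) R) : Prop :=
  forall (L : {fset int}) (f : conf E -> R), cont_conf f ->
    (\int[mu]_x (spec_int gamma L f x)%:E = \int[mu]_x (f x)%:E)%E.

(* Main.v *)
(** Fix a reference symbol [e0]. The measure has full support, so its continuous
    conditional probabilities are unique and shift invariance of [mu] passes to
    the single-site kernels. The potential is
      phi(w) = ln gamma_0(w_0 | e0 .. e0 w_1 w_2 ..)
               - ln gamma_0(e0 | e0 .. e0 w_1 w_2 ..),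
    where all sites to the left of 0 carry [e0]. Replacing symbols by [e0] one
    site at a time, consistency makes the sums of phi over an interval telescope
    into log-ratios of the kernel of that interval. Over [-n, 0] the sum defining
    extensibility becomes the single-site log-ratio at 0 with [e0] to the left of
    -n, which converges uniformly. Over [0, n) the telescoping is exact up to the
    boundary condition on the left, whose effect is a sum of n moduli of
    continuity, hence o(n). So ln mu[w_0 .. w_(n-1)] = S_n phi(w) - P_n + o(n)
    uniformly, with P_n the logarithm of the partition function. Integrating,
    H_n(mu) + n int phi dmu = P_n + o(n), and P_n / n converges since P_n is
    subadditive. *)

Require Import Defs.
From HB Require Import structures.
From mathcomp Require Import all_boot all_order all_algebra finmap.
From mathcomp Require Import all_classical all_reals all_analysis.
From mathcomp Require Import measurable_realfun zify ring lra.
Import Order.TTheory GRing.Theory Num.Theory.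
Import numFieldNormedType.Exports.
Local Open Scope ring_scope.
Local Open Scope classical_set_scope.

Set Implicit Arguments.
Unset Strict Implicit.
Unset Printing Implicit Defensive.

(** * Configurations and continuity *)

Definition agree (E : finType) (N : nat) (w w' : conf E) : Prop :=
  forall k : int, (absz k <= N)%N -> w' k = w k.

Lemma agree_sym (E : finType) (N : nat) (w w' : conf E) :
  agree N w w' -> agree N w' w.
Proof. by move=> h k /h. Qed.

Lemma agree_le (E : finType) (M N : nat) (w w' : conf E) :
  (M <= N)%N -> agree N w w' -> agree M w w'.
Proof. by move=> MN h k kM; apply: h; exact: leq_trans MN. Qed.

(** Compactness of the configuration space. Along an ultrafilter finer than the eventual filter,
    each site has one symbol that occurs for almost all indices, since [E] is finite; these symbols
    form [v]. *)
Lemma limit_point_conf (E : finType) (w : nat -> conf E) :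
  exists v : conf E, forall N : nat, exists2 n, (N <= n)%N & agree N v (w n).
Proof.
have [U [UU sU]] := ultraFilterLemma (eventually_filter : ProperFilter _).
have ex k : exists e, U [set n | w n k = e].
  apply: contrapT => /forallNP noe.
  have hU : U [set n | forall e, w n k <> e].
    apply: filter_forall => e.
    by case: (in_ultra_setVsetC [set n | w n k = e] UU) => // /noe.
  by have [n /(_ (w n k))] := filter_ex hU.
pose v k := projT1 (cid (ex k)).
have vP k : U [set n | w n k = v k] by rewrite /v; case: cid.
exists v => N.
have h : U [set n | forall i : 'I_N.+1,
    w n i%:Z = v i%:Z /\ w n (- i%:Z) = v (- i%:Z)].
  by apply: filter_forall => i; apply: filterI; exact: vP.
have hN : U [set n | (N <= n)%N] by apply: sU; exists N.
have [n [hn Nn]] := filter_ex (filterI h hN); exists n => // k kN.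
have [hp hm] := hn (@Ordinal N.+1 (absz k) kN).
by case: (intP k) kN hp hm => //= m _ hp hm; rewrite -?NegzE.
Qed.

Section continuity.
Context {R : realType} {E : finType}.
Implicit Types (f g : conf E -> R) (w : conf E).

(** Heine's argument: pairs that agree on ever larger windows while their values stay [eps] apart
    would accumulate at some [v], where continuity brings both values within [eps / 2] of [f v]. *)
Lemma cont_conf_unif f : cont_conf f ->
  forall eps : R, 0 < eps -> exists N : nat, forall w w',
    agree N w w' -> `|f w' - f w| < eps.
Proof.
move=> cf eps eps0; apply: contrapT => /forallNP nf.
have {nf}nf N : exists w w', agree N w w' /\ eps <= `|f w' - f w|.
  apply: contrapT => /forallNP h; apply: (nf N) => w w' ww'.
  by rewrite ltNge; apply/negP => le; apply: (h w); exists w'.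
pose x N := projT1 (cid (nf N)).
pose y N := projT1 (cid (projT2 (cid (nf N)))).
have xyP N : agree N (x N) (y N) /\ eps <= `|f (y N) - f (x N)|.
  exact: (projT2 (cid (projT2 (cid (nf N))))).
have [v vP] := limit_point_conf x.
have e2 : 0 < eps / 2 by rewrite divr_gt0.
have [N hN] := cf v _ e2.
have [n Nn vn] := vP N; have [xyn] := xyP n; apply/negP; rewrite -ltNge.
have h1 := hN _ vn.
have h2 : `|f (y n) - f v| < eps / 2.
  by apply: hN => k kN; rewrite xyn ?vn// (leq_trans kN).
rewrite (_ : f (y n) - f (x n) = (f (y n) - f v) - (f (x n) - f v)); last by ring.
by rewrite (splitr eps) (le_lt_trans (ler_normB _ _))// ltrD.
Qed.

Lemma cont_conf_comp f (T : conf E -> conf E) (M : nat -> nat) :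
  (forall N w w', agree (M N) w w' -> agree N (T w) (T w')) ->
  cont_conf f -> cont_conf (f \o T).
Proof.
move=> TM cf w eps /(cf (T w))[N hN]; exists (M N) => w' h; apply: hN.
exact: TM.
Qed.

Lemma cont_conf_post (h : R -> R) f :
  (forall w, {for f w, continuous h}) -> cont_conf f -> cont_conf (h \o f).
Proof.
move=> ch cf w eps eps0; have /cvgrPdist_lt/(_ _ eps0) := ch w.
move=> /nbhs_ballP[d /= d0 hd].
have [N hN] := cf w d d0; exists N => w' /hN ww' /=.
by rewrite distrC; apply: hd; rewrite /ball/= distrC.
Qed.

Lemma cont_conf_local f N : (forall w w', agree N w w' -> f w' = f w) ->
  cont_conf f.
Proof.
by move=> h w eps eps0; exists N => w' /h ->; rewrite subrr normr0.
Qed.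

Lemma cont_conf_cst (c : R) : cont_conf (fun _ : conf E => c).
Proof. by apply: (@cont_conf_local _ 0%N). Qed.

Lemma cont_confD f g : cont_conf f -> cont_conf g ->
  cont_conf (fun w => f w + g w).
Proof.
move=> cf cg w eps eps0; have e2 : 0 < eps / 2 by rewrite divr_gt0.
have [N hN] := cf w _ e2; have [M hM] := cg w _ e2.
exists (maxn N M) => w' h.
have h1 := hN w' (agree_le (leq_maxl _ _) h).
have h2 := hM w' (agree_le (leq_maxr _ _) h).
rewrite (_ : _ - _ = (f w' - f w) + (g w' - g w)); last by ring.
by rewrite (splitr eps) (le_lt_trans (ler_normD _ _))// ltrD.
Qed.

Lemma cont_confM f g : cont_conf f -> cont_conf g ->
  cont_conf (fun w => f w * g w).
Proof.
move=> cf cg w eps eps0.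
pose A := `|f w| + `|g w| + 1.
have A0 : 0 < A by rewrite ltr_wpDl// addr_ge0.
(* The bound [d <= 1] absorbs the product of the two increments, so that the whole error stays below
   [d * A]. *)
pose d := Num.min 1 (eps / A).
have d0 : 0 < d by rewrite lt_min ltr01 divr_gt0.
have [N hN] := cf w _ d0; have [M hM] := cg w _ d0.
exists (maxn N M) => w' h.
have h1 := hN w' (agree_le (leq_maxl _ _) h).
have h2 := hM w' (agree_le (leq_maxr _ _) h).
rewrite (_ : _ - _ = (f w' - f w) * (g w' - g w) + (f w' - f w) * g w
   + f w * (g w' - g w)); last by ring.
rewrite (le_lt_trans (ler_normD _ _))//.
rewrite (le_lt_trans (lerD (ler_normD _ _) (lexx _)))//.
rewrite !normrM.
have d1 : d <= 1 by rewrite ge_min lexx.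
have dA : d * A <= eps.
  by rewrite -ler_pdivlMr// ge_min lexx orbT.
apply: lt_le_trans dA; rewrite /A.
have := normr_ge0 (f w); have := normr_ge0 (g w).
have := normr_ge0 (f w' - f w); have := normr_ge0 (g w' - g w).
move: h1 h2 d1 d0; move: (`|_ - _|) (`|_ - _|) `|f w| `|g w| => p q x y.
by nra.
Qed.

Lemma cont_confZ (c : R) f : cont_conf f -> cont_conf (fun w => c * f w).
Proof. by apply: cont_confM; exact: cont_conf_cst. Qed.

Lemma cont_confB f g : cont_conf f -> cont_conf g ->
  cont_conf (fun w => f w - g w).
Proof.
move=> cf cg; apply: cont_confD => //.
rewrite (_ : (fun _ => _) = fun w => -1 * g w); first exact: cont_confZ.
by apply/funext => w; rewrite mulN1r.
Qed.

Lemma cont_conf_sum (I : Type) (s : seq I) (F : I -> conf E -> R) :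
  (forall i, cont_conf (F i)) -> cont_conf (fun w => \sum_(i <- s) F i w).
Proof.
move=> cF; elim: s => [|i s ih].
  by under [X in cont_conf X]funext do rewrite big_nil; exact: cont_conf_cst.
by under [X in cont_conf X]funext do rewrite big_cons; exact: cont_confD.
Qed.

End continuity.
(** * Integration of continuous functions *)

Section integration.
Context {R : realType} {E : finType} {e0 : E}.
Implicit Types (f g : conf E -> R) (w : conf E).

Definition window_pattern (N : nat) w : {ffun 'I_(N + N).+1 -> E} :=
  [ffun i : 'I_(N + N).+1 => w ((i : nat)%:Z - N%:Z)].

Definition pattern_conf (N : nat) (p : {ffun 'I_(N + N).+1 -> E}) : conf E :=
  fun k => if (absz k <= N)%N then p (inord (absz (k + N%:Z))) else e0.

Lemma agree_pattern N w : agree N w (pattern_conf (window_pattern N w)).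
Proof.
move=> k kN; rewrite /pattern_conf kN ffunE inordK; last by lia.
by congr w; lia.
Qed.

Lemma measurable_window_pattern N (p : {ffun 'I_(N + N).+1 -> E}) :
  measurable ([set w | window_pattern N w = p] : set (Omega e0)).
Proof.
rewrite [X in measurable X](_ : _ = \bigcap_(i in [set: 'I_(N + N).+1])
    [set w : Omega e0 | w ((i : nat)%:Z - N%:Z) = p i]).
  apply: fin_bigcap_measurable => // i _.
  by apply: sub_sigma_algebra; exists ((i : nat)%:Z - N%:Z), (p i).
apply/seteqP; split => w /=; first by move=> <- i _ /=; rewrite ffunE.
by move=> h; apply/ffunP => i; rewrite ffunE h.
Qed.

Lemma pattern_indicE N (F : {ffun 'I_(N + N).+1 -> E} -> R) w :
  F (window_pattern N w) =
    \sum_p F p * \1_[set v | window_pattern N v = p] w.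
Proof.
rewrite (bigD1 (window_pattern N w))//= big1 ?addr0; last first.
  move=> p /negP pw; rewrite indicE memNset ?mulr0//= => wp.
  by apply: pw; rewrite wp.
by rewrite indicE mem_set ?mulr1.
Qed.

(** [f] is the pointwise limit of its values on window patterns filled up with [e0], and each
    approximation is a finite combination of indicators of cylinder sets. *)
Lemma measurable_cont_conf f : cont_conf f ->
  measurable_fun [set: Omega e0] (f : Omega e0 -> R).
Proof.
move=> cf.
apply: (@measurable_fun_cvg _ (Omega e0) R _
  (fun N (w : Omega e0) => f (pattern_conf (window_pattern N w)))) => [N|w _].
  rewrite (_ : (fun w => _) = fun w : Omega e0 => \sum_p f (pattern_conf p) *
      \1_[set v : Omega e0 | window_pattern N v = p] w); last first.
    by apply/funext => w; exact: (pattern_indicE (f \o @pattern_conf N)).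
  apply: measurable_sum => p; apply: measurable_funM => //.
  by apply: measurable_indic; exact: measurable_window_pattern.
apply/cvgrPdist_lt => eps /(cf w)[N hN]; exists N => // n /= Nn.
by rewrite distrC; apply: hN; apply: agree_le Nn _; exact: agree_pattern.
Qed.

(** For a suitable window, every value lies within 1 of the value at one of finitely many
    patterns. *)
Lemma bounded_cont_conf f : cont_conf f -> exists B, forall w, `|f w| <= B.
Proof.
move=> cf; have [N hN] := cont_conf_unif cf ltr01.
exists (1 + \sum_p `|f (@pattern_conf N p)|) => w.
have /ltW h := hN _ _ (agree_sym (@agree_pattern N w)).
rewrite -[f w](subrK (f (pattern_conf (window_pattern N w)))).
rewrite (le_trans (ler_normD _ _))// lerD//.
by rewrite (bigD1 (window_pattern N w))//= lerDl sumr_ge0.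
Qed.

(** The modulus is the supremum of the oscillations over pairs agreeing on [[-N, N]]. Its Cesaro
    means later bound the error per site. *)
Lemma cont_conf_modulus f : cont_conf f ->
  exists2 delta : nat -> R, delta @ \oo --> 0 &
    forall N w w', agree N w w' -> `|f w' - f w| <= delta N.
Proof.
move=> cf; have [B hB] := bounded_cont_conf cf.
pose A N := [set x : R | exists w w', agree N w w' /\ x = `|f w' - f w|].
have A0 N : A N 0.
  by exists (fun _ => e0), (fun _ => e0); split => //; rewrite subrr normr0.
have AB N : ubound (A N) (B + B).
  by move=> _ [w [w' [_ ->]]]; rewrite (le_trans (ler_normB _ _))// lerD.
have sA N x : A N x -> x <= sup (A N).
  by move=> Ax; apply: ub_le_sup => //; exists (B + B).
exists (fun N => sup (A N)) => [|N w w' ww'].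
- apply/cvgrPdist_le => eps eps0; have [N hN] := cont_conf_unif cf eps0.
  exists N => // n /= Nn; rewrite sub0r normrN ger0_norm; last exact: sA.
  apply: ge_sup; first by exists 0.
  by move=> _ [w [w' [/(agree_le Nn) /hN/ltW ? ->]]].
- by apply: sA; exists w, w'.
Qed.

(** * Means of continuous functions *)

Context (mu : probability (Omega e0) R).

Definition mean f : R := (\int[mu]_(x in [set: Omega e0]) f x)%R.

Lemma integrable_cont_conf f : cont_conf f ->
  mu.-integrable [set: Omega e0] (EFin \o f).
Proof.
move=> cf; apply: measurable_bounded_integrable => //.
- by rewrite (le_lt_trans (probability_le1 mu measurableT))// ltry.
- exact: measurable_cont_conf.
- have [B hB] := bounded_cont_conf cf.
  exists B; split; first exact: num_real.
  by move=> M BM w _; apply: (le_trans (hB w)); exact: ltW.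
Qed.

Lemma mean_le f g : cont_conf f -> cont_conf g ->
  (forall w, f w <= g w) -> mean f <= mean g.
Proof.
by move=> cf cg fg; apply: le_Rintegral => //; exact: integrable_cont_conf.
Qed.

Lemma meanD f g : cont_conf f -> cont_conf g ->
  mean (fun w => f w + g w) = mean f + mean g.
Proof. by move=> cf cg; apply: RintegralD => //; exact: integrable_cont_conf. Qed.

Lemma meanB f g : cont_conf f -> cont_conf g ->
  mean (fun w => f w - g w) = mean f - mean g.
Proof. by move=> cf cg; apply: RintegralB => //; exact: integrable_cont_conf. Qed.

Lemma meanZ c f : cont_conf f -> mean (fun w => c * f w) = c * mean f.
Proof. by move=> cf; apply: RintegralZl => //; exact: integrable_cont_conf. Qed.

Lemma mean_cst c : mean (fun _ => c) = c.
Proof.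
rewrite /mean Rintegral_cst// -[RHS]mulr1 -[X in _ = _ * X]/(fine 1%E).
by congr (_ * fine _); exact: probability_setT.
Qed.

Lemma mean_sum (I : Type) (s : seq I) (F : I -> conf E -> R) :
  (forall i, cont_conf (F i)) ->
  mean (fun w => \sum_(i <- s) F i w) = \sum_(i <- s) mean (F i).
Proof.
move=> cF; elim: s => [|i s ih].
  by rewrite big_nil; under [X in mean X]funext do rewrite big_nil;
    exact: mean_cst.
rewrite big_cons -ih -meanD//; last exact: cont_conf_sum.
by congr mean; apply/funext => w; rewrite big_cons.
Qed.

Lemma cont_indic_measurable (A : set (conf E)) :
  cont_conf (\1_A : conf E -> R) -> measurable (A : set (Omega e0)).
Proof. by move=> /measurable_cont_conf/measurable_indicP. Qed.

Lemma mean_indic (A : set (conf E)) : cont_conf (\1_A : conf E -> R) ->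
  mean \1_A = fine (mu A).
Proof.
move=> /cont_indic_measurable mA.
by rewrite /mean /Rintegral integral_indic// setIT.
Qed.

Lemma measurable_shift :
  measurable_fun [set: Omega e0] (@Defs.shift E : Omega e0 -> Omega e0).
Proof.
apply: (@measurability _ _ (Omega e0) (Omega e0) setT _ (cylsets e0)) => //.
move=> _ [_ [k [a ->]] <-]; rewrite setTI.
by apply: sub_sigma_algebra; exists (k + 1), a.
Qed.

Lemma agree_shift N w w' :
  agree N.+1 w w' -> agree N (Defs.shift w) (Defs.shift w').
Proof. by move=> h k kN; apply: h; lia. Qed.

Lemma cont_conf_shift f : cont_conf f -> cont_conf (f \o Defs.shift).
Proof. by apply: (cont_conf_comp (M := S)); exact: agree_shift. Qed.

Lemma cont_conf_shiftn f (n : nat) : cont_conf f ->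
  cont_conf (fun w => f (shiftn n%:Z w)).
Proof.
apply: (@cont_conf_comp _ _ f (shiftn n%:Z) (addn n)) => N w w' h k kN.
by apply: h; lia.
Qed.

Lemma mean_shift f : shift_invariant mu -> cont_conf f ->
  mean (f \o Defs.shift) = mean f.
Proof.
move=> muS cf; rewrite /mean /Rintegral; congr fine.
rewrite -(@integral_pushforward _ _ _ _ _ _ measurable_shift mu setT (EFin \o f))//.
- apply: eq_measure_integral => [|m A mA _]; first exact: measurable_shift.
  exact: muS.
- by apply/measurable_EFinP; exact: measurable_cont_conf.
- exact/integrable_cont_conf/cont_conf_shift.
Qed.

End integration.
(** * Specifications *)

Section patching.
Context {E : finType}.
Implicit Types (w v : conf E) (L D : {fset int}).

Lemma patch_in L (xi : {ffun L -> E}) w k (kL : k \in L) :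
  Defs.patch L xi w k = xi (FSetSub kL).
Proof. by rewrite /Defs.patch insubT. Qed.

Lemma patch_out L (xi : {ffun L -> E}) w k : k \notin L ->
  Defs.patch L xi w k = w k.
Proof. by move=> kL; rewrite /Defs.patch insubN. Qed.

Lemma restr_patch L (xi : {ffun L -> E}) w :
  Defs.restr L (Defs.patch L xi w) = xi.
Proof.
apply/ffunP => i; rewrite ffunE (patch_in _ _ (valP i)).
by congr (xi _); exact: val_inj.
Qed.

(** A form of [patch] whose inner symbols come from a full configuration, which avoids functions
    indexed by the subtype of [L]. *)
Definition merge L v w : conf E := fun k => if k \in L then v k else w k.

Lemma patch_restr L v w : Defs.patch L (Defs.restr L v) w = merge L v w.
Proof.
apply/funext => k; rewrite /merge; case: ifPn => kL; last exact: patch_out.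
by rewrite patch_in ffunE.
Qed.

Definition cylinder_on L v : set (conf E) :=
  [set w | forall k, k \in L -> w k = v k].

Lemma patch_cylinder L (xi : {ffun L -> E}) v w :
  cylinder_on L v (Defs.patch L xi w) <-> xi = Defs.restr L v.
Proof.
split=> [h|->].
  apply/ffunP => i; rewrite ffunE -h ?(valP i)//.
  by rewrite (patch_in _ _ (valP i)); congr (xi _); exact: val_inj.
by rewrite patch_restr => k kL; rewrite /merge kL.
Qed.

Lemma fset_window L : exists N, forall k, k \in L -> (absz k <= N)%N.
Proof.
exists (\sum_(k <- L) absz k)%N => k kL.
by rewrite (big_fsetD1 k)//= leq_addr.
Qed.

Lemma agree_merge L v N w w' :
  agree N w w' -> agree N (merge L v w) (merge L v w').
Proof. by move=> h k kN; rewrite /merge; case: ifP => // _; exact: h. Qed.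

Lemma cont_cylinder_on (R : realType) L v :
  cont_conf (\1_(cylinder_on L v) : conf E -> R).
Proof.
have [N hN] := fset_window L; apply: (@cont_conf_local _ _ _ N) => w w' ww'.
rewrite !indicE; congr (_%:R); congr nat_of_bool; apply/idP/idP;
  rewrite !inE => h k kL.
  by rewrite -ww' ?h// hN.
by rewrite ww' ?h// hN.
Qed.

End patching.

(** * Positivity and consistency of the kernels *)

Section specification.
Context {R : realType} {E : finType} (gamma : spec_type R E).
Arguments gamma : clear implicits.
Hypothesis gammaG : gibbsian gamma.
Implicit Types (w v : conf E) (L D : {fset int}).

(** Pattern and boundary condition are both read off [w]; non-nullness and continuity of a
    specification are statements about this function. *)
Definition local_weight L w : R := gamma L w (Defs.restr L w).

Local Notation G := local_weight.

Lemma spec_weightE L w (xi : {ffun L -> E}) :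
  gamma L w xi = G L (Defs.patch L xi w).
Proof.
have [[h _ _ _] _ _] := gammaG.
rewrite /local_weight restr_patch.
by rewrite (h L w (Defs.patch L xi w))// => k kL; rewrite patch_out.
Qed.

Lemma local_weight_lb L : exists2 c : R, 0 < c & forall w, c <= G L w.
Proof. by have [_ /(_ L)[c [c0 h]] _] := gammaG; exists c. Qed.

Lemma local_weight_gt0 L w : 0 < G L w.
Proof. by have [c c0 /(_ w)] := local_weight_lb L; exact: lt_le_trans. Qed.

Lemma cont_local_weight L : cont_conf (G L).
Proof. by have [_ _] := gammaG; apply. Qed.

(** The indicator kills all patterns on [L] but that of [v], so a cylinder test function extracts a
    single kernel value. *)
Lemma spec_int_cylinder L v (f : conf E -> R) w :
  spec_int gamma L (fun x => \1_(cylinder_on L v) x * f x) w =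
  G L (merge L v w) * f (merge L v w).
Proof.
rewrite /spec_int (bigD1 (Defs.restr L v))//= big1 ?addr0; last first.
  move=> xi xiv; rewrite indicE memNset ?mul0r ?mulr0//.
  by move=> /patch_cylinder xivE; rewrite xivE eqxx in xiv.
rewrite indicE mem_set; last exact/patch_cylinder.
by rewrite mul1r spec_weightE patch_restr.
Qed.

Lemma spec_int_conf1 L v w :
  spec_int gamma L \1_[set v] w =
  G L v * \1_[set x : conf E | forall k, k \notin L -> x k = v k] w.
Proof.
have := spec_int_cylinder L v \1_[set v] w.
rewrite (_ : (fun x => _) = \1_[set v]); last first.
  apply/funext => x; rewrite !indicE -[RHS]mul1r.
  have [->|] := pselect (x = v); first by rewrite !mem_set.
  by move=> xv; rewrite !(@memNset _ [set v]) ?mulr0.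
move=> ->; rewrite !indicE; have [wv|wv] := 
  pselect (forall k, k \notin L -> w k = v k).
  have -> : merge L v w = v.
    by apply/funext => k; rewrite /merge; case: ifPn => // /wv.
  by rewrite !mem_set.
rewrite !memNset ?mulr0//= => vw; apply: wv => /= k kL.
by rewrite -[in RHS]vw /merge (negbTE kL).
Qed.

(* Consistency tested on the indicator of a single configuration. *)
Lemma local_weight_ratio D L w w' : fsubset D L ->
  (forall k, k \notin D -> w k = w' k) ->
  G L w * G D w' = G L w' * G D w.
Proof.
move=> DL ww'; have [[_ _ _ cons] _ _] := gammaG.
(* The factor next to [G D v] depends on [v] only outside [D], hence is the same for [w] and
   [w']. *)
have LD v : G L v = G D v *
    \sum_(xi : {ffun L -> E}) gamma L v xi *
      \1_[set x : conf E | forall k, k \notin D -> x k = v k] (Defs.patch L xi v).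
  have := cons L D DL \1_[set v] v; rewrite spec_int_conf1.
  rewrite [X in _ * X]indicE mem_set// mulr1 => <-.
  rewrite mulr_sumr; apply: eq_bigr => xi _.
  by rewrite spec_int_conf1 mulrCA.
have wL k : k \notin L -> w k = w' k.
  by move=> kL; apply: ww'; apply: contra kL; exact: (fsubsetP DL).
rewrite (LD w) (LD w') (_ : \sum_xi _ = \sum_(xi : {ffun L -> E}) gamma L w' xi *
  \1_[set x : conf E | forall k, k \notin D -> x k = w' k] (Defs.patch L xi w')).
  by ring.
have [[hL _ _ _] _ _] := gammaG.
apply: eq_bigr => xi _; rewrite (hL L w w')//; congr (_ * \1_ _ _).
  apply/seteqP; split=> x /= h k kD; first by rewrite h// ww'.
  by rewrite h// ww'.
apply/funext => k; have [kL|kL] := boolP (k \in L).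
  by rewrite !patch_in.
by rewrite !patch_out// wL.
Qed.
End specification.
(** * Gibbs measures *)

Definition sites (m : int) (n : nat) : {fset int} :=
  [fset (m + i%:Z)%R | i in iota 0 n]%fset.

Lemma in_sites m n k : (k \in sites m n) = (m <= k) && (k < m + n%:Z).
Proof.
apply/imfsetP/andP => [[i /=]|[mk kn]].
  by rewrite mem_iota => /andP[_ i_n] ->; lia.
by exists (absz (k - m)); rewrite /= ?mem_iota; lia.
Qed.

Definition set_site (E : finType) (i : int) (b : E) (w : conf E) : conf E :=
  merge [fset i]%fset (fun _ => b) w.

Lemma set_siteE (E : finType) i (b : E) w k :
  set_site i b w k = if k == i then b else w k.
Proof. by rewrite /set_site /merge in_fset1. Qed.

Lemma agree_set_site (E : finType) i (b : E) N w w' :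
  agree N w w' -> agree N (set_site i b w) (set_site i b w').
Proof. exact: agree_merge. Qed.

Lemma set_site_id (E : finType) i (w : conf E) : set_site i (w i) w = w.
Proof. by apply/funext => k; rewrite set_siteE; case: eqP => // ->. Qed.

Lemma set_siteK (E : finType) i (a b : E) w :
  set_site i a (set_site i b w) = set_site i a w.
Proof. by apply/funext => k; rewrite !set_siteE; case: eqP. Qed.

Section gibbs_measure.
Context {R : realType} {E : finType} {e0 : E} (mu : probability (Omega e0) R).
Context (gamma : spec_type R E).
Hypotheses (gammaG : gibbsian gamma) (muG : is_gibbs_for gamma mu).
Implicit Types (w v : conf E) (L D : {fset int}) (f : conf E -> R).

Local Notation G := (local_weight gamma).

(** The DLR equation for the indicator of the cylinder times [f], whose kernel integral reduces to a
    single term. *)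
Lemma mean_cylinder_on L v f : cont_conf f ->
  mean mu (fun w => \1_(cylinder_on L v) w * f w) =
  mean mu (fun w => G L (merge L v w) * f (merge L v w)).
Proof.
move=> cf.
have cg : cont_conf (fun w => \1_(cylinder_on L v) w * f w).
  by apply: cont_confM => //; exact: cont_cylinder_on.
rewrite /mean /Rintegral; congr fine; rewrite -(muG L cg).
by apply: eq_integral => w _; rewrite spec_int_cylinder.
Qed.

Lemma cont_weight_merge L D v : cont_conf (fun w => G L (merge D v w)).
Proof.
apply: (@cont_conf_comp _ _ (G L) (merge D v) id); last exact: cont_local_weight.
by move=> N w w'; exact: agree_merge.
Qed.

Lemma mean_cylinder_onE L v :
  mean mu \1_(cylinder_on L v) = mean mu (fun w => G L (merge L v w)).
Proof.
have := mean_cylinder_on L v (cont_conf_cst (1 : R)).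
by under [X in mean _ X = _]funext do rewrite mulr1;
  under [X in _ = mean _ X]funext do rewrite mulr1.
Qed.

(** A positive value [f w] keeps [f] above [f w / 2] on a cylinder around [w]. By the DLR equation
    the measure of this cylinder is a mean of kernel values, which non-nullness bounds below by
    [c > 0]. *)
Lemma full_support f : cont_conf f -> (forall w, 0 <= f w) ->
  mean mu f = 0 -> forall w, f w = 0.
Proof.
move=> cf f0 mf w; apply/eqP; rewrite eq_le f0 andbT leNgt; apply/negP => fw.
have [N hN] := cf w _ (divr_gt0 fw (ltr0Sn R 1)).
pose L := sites (- N%:Z) (N + N).+1.
have [c c0 hc] := local_weight_lb gammaG L.
have cL : cont_conf (fun x => f w / 2 * \1_(cylinder_on L w) x).
  by apply: cont_confZ; exact: cont_cylinder_on.
have : f w / 2 * c <= mean mu f.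
  apply: (@le_trans _ _ (mean mu (fun x => f w / 2 * \1_(cylinder_on L w) x))).
    rewrite meanZ; last exact: cont_cylinder_on.
    rewrite ler_pM2l ?divr_gt0// mean_cylinder_onE -[c](mean_cst mu).
    by apply: mean_le => //; [exact: cont_conf_cst|exact: cont_weight_merge].
  apply: mean_le => // x; rewrite indicE; case: (boolP (x \in _)) => xL.
    have /hN : agree N w x.
      by move=> k kN; move: xL; rewrite inE; apply; rewrite in_sites; lia.
    by rewrite mulr1 ltr_norml => /andP[+ _]; lra.
  by rewrite mulr0.
by rewrite mf leNgt mulr_gt0// divr_gt0.
Qed.

Definition site_weight w i : R := G [fset i]%fset w.

Lemma site_weight_gt0 w i : 0 < site_weight w i.
Proof. exact: local_weight_gt0. Qed.

Hypothesis muS : shift_invariant mu.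

(* The difference of the two sides, with the symbol at the site fixed to [b],
   does not depend on that site; testing it against itself shows that its
   square has mean zero. *)
Lemma site_weight_shift w i :
  site_weight w (i + 1) = site_weight (Defs.shift w) i.
Proof.
pose unshift w : conf E := fun k => w (k - 1).
have unshiftK v : unshift (Defs.shift v) = v.
  by apply/funext => k; rewrite /unshift /Defs.shift subrK.
set b := w (i + 1).
pose U j v := site_weight (set_site j b v) j.
pose d v := U (i + 1) v - U i (Defs.shift v).
have cU j : cont_conf (U j) by exact: cont_weight_merge.
have cd : cont_conf d by apply: cont_confB => //; exact: cont_conf_shift.
have cd' : cont_conf (d \o unshift).
  apply: (cont_conf_comp (M := S)) => // N v v' h k kN; apply: h; lia.
have U_set j v : U j (set_site j b v) = U j v by rewrite /U set_siteK.
have d_set v : d (set_site (i + 1) b v) = d v.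
  rewrite /d U_set; congr (_ - _); rewrite /U; congr (site_weight _ _).
  apply/funext => k; rewrite !set_siteE; case: eqP => // ki.
  by rewrite /Defs.shift set_siteE (inj_eq (addIr 1)); case: eqP.
have d'_set v : (d \o unshift) (set_site i b v) = (d \o unshift) v.
  rewrite /= -d_set -[RHS]d_set; congr d; apply/funext => k.
  by rewrite !set_siteE /unshift set_siteE; case: eqP => // ki; case: eqP => //; lia.
pose A j : conf E -> R := \1_(cylinder_on [fset j]%fset (fun=> b)).
have cA j : cont_conf (A j) by exact: cont_cylinder_on.
(* Since [d] ignores the symbol at [i + 1], the DLR equation at that site lets the weight
   [U (i + 1)] be replaced, in mean, by the event that the site carries [b]. *)
have e1 : mean mu (fun v => U (i + 1) v * d v) =
          mean mu (fun v => A (i + 1) v * d v).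
  rewrite mean_cylinder_on//; congr mean; apply/funext => v.
  by rewrite -[in LHS](d_set v).
(* Invariance moves the mean to unshifted coordinates, the DLR equation is applied at site [i], and
   invariance carries the event back to [i + 1]. *)
have e2 : mean mu (fun v => U i (Defs.shift v) * d v) =
          mean mu (fun v => A (i + 1) v * d v).
  transitivity (mean mu (fun v => U i v * (d \o unshift) v)).
    rewrite -[RHS](mean_shift muS); last exact: cont_confM.
    by congr mean; apply/funext => v /=; rewrite unshiftK.
  transitivity (mean mu (fun v => A i v * (d \o unshift) v)).
    rewrite mean_cylinder_on//; congr mean; apply/funext => v.
    by rewrite -[in LHS](d'_set v).
  rewrite -[LHS](mean_shift muS); last exact: cont_confM.
  congr mean; apply/funext => v /=; rewrite unshiftK /A !indicE.
  congr (_%:R * _); congr nat_of_bool; apply/idP/idP; rewrite !inE => h k;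
    rewrite in_fset1 => /eqP->.
    by rewrite -(h i) ?in_fset1.
  by rewrite -(h (i + 1)) ?in_fset1.
have d2 : mean mu (fun v => d v * d v) = 0.
  under [X in mean _ X]funext do rewrite {1}/d mulrBl.
  rewrite meanB ?e1 ?e2 ?subrr//; apply: cont_confM => //.
  exact: cont_conf_shift.
have /(_ w)/eqP : forall v, d v * d v = 0.
  apply: full_support => //; first exact: cont_confM.
  by move=> v; rewrite -expr2 sqr_ge0.
rewrite mulf_eq0 orbb subr_eq0 => /eqP; rewrite /U.
rewrite set_site_id => ->; congr site_weight.
by rewrite /b -[w (i + 1)]/(Defs.shift w i) set_site_id.
Qed.

Lemma site_weight_shiftn w i : site_weight w i = site_weight (shiftn i w) 0.
Proof.
have sh (n : nat) v j : site_weight v (j + n%:Z) = site_weight (shiftn n%:Z v) j.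
  elim: n v j => [|n ih] v j.
    by rewrite addr0; congr site_weight; apply/funext => k; rewrite /shiftn addr0.
  rewrite (_ : j + _ = j + n%:Z + 1); last by lia.
  rewrite site_weight_shift ih; congr site_weight; apply/funext => k.
  by rewrite /shiftn /Defs.shift; congr (v _); lia.
case: (intP i) => [|n|n]; last first.
(* For negative [i], the nonnegative case is applied to [shiftn i w]. *)
- rewrite -[in RHS](addNr n.+1%:Z) sh; congr site_weight; apply/funext => k.
  by rewrite /shiftn; congr (w _); lia.
- by rewrite -[in LHS](add0r n.+1%:Z) sh.
- by congr site_weight; apply/funext => k; rewrite /shiftn addr0.
Qed.

End gibbs_measure.
(** * The potential *)

Definition blank_left (E : finType) (e0 : E) (m : int) (w : conf E) : conf E :=
  fun k => if k < m then e0 else w k.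

Section potential.
Context {R : realType} {E : finType} (e0 : E) (gamma : spec_type R E).
Hypothesis gammaG : gibbsian gamma.
Hypothesis gammaS : forall (w : conf E) i,
  site_weight gamma w i = site_weight gamma (shiftn i w) 0.
Implicit Types (w v : conf E) (L D : {fset int}).

Local Notation G := (local_weight gamma).

Definition log_ratio w i : R :=
  ln (site_weight gamma w i) - ln (site_weight gamma (set_site i e0 w) i).

Definition blank m n w : conf E := merge (sites m n) (fun=> e0) w.

Definition potential w : R := log_ratio (blank_left e0 0 w) 0.

Lemma log_ratio_shiftn w i : log_ratio w i = log_ratio (shiftn i w) 0.
Proof.
rewrite /log_ratio gammaS [in X in _ - X]gammaS; congr (_ - ln _).
congr site_weight; apply/funext => k.
by rewrite /shiftn !set_siteE; congr (if _ then _ else _); lia.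
Qed.

(** Consistency with the single site [i]: normalisations cancel in ratios, so changing one symbol
    has the same effect on the kernel of every [L] containing that site. *)
Lemma ln_weight_set_site L w i : i \in L ->
  ln (G L w) - ln (G L (set_site i e0 w)) = log_ratio w i.
Proof.
move=> iL.
have DL : fsubset [fset i]%fset L by rewrite fsub1set.
have h k : k \notin [fset i]%fset -> w k = set_site i e0 w k.
  by rewrite in_fset1 set_siteE => /negbTE->.
have := congr1 (@ln R) (local_weight_ratio gammaG DL h).
rewrite !lnM ?posrE ?local_weight_gt0// /log_ratio /site_weight; lra.
Qed.

Lemma blankS m n w : blank m n.+1 w = set_site (m + n%:Z) e0 (blank m n w).
Proof.
apply/funext => k; rewrite set_siteE /blank /merge !in_sites.
by case: eqP => kn; do ?[case: ifPn => ?] => //; lia.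
Qed.

(** Blanking the sites from left to right telescopes: when site [m + j] is replaced, the sites from
    [m] to [m + j - 1] already carry [e0]. *)
Lemma ln_weight_blank L m n w : (forall j : nat, (j < n)%N -> m + j%:Z \in L) ->
  ln (G L w) - ln (G L (blank m n w)) =
  \sum_(j < n) log_ratio (blank m j w) (m + (j : nat)%:Z).
Proof.
elim: n => [|n ih] hL.
  rewrite big_ord0 (_ : blank m 0 w = w) ?subrr//.
  by apply/funext => k; rewrite /blank /merge in_sites; case: ifP => //; lia.
rewrite big_ord_recr /= -ih; last by move=> j jn; apply: hL; exact: ltnW.
rewrite blankS -(ln_weight_set_site (L := L)); last exact: hL.
by lra.
Qed.

(** Non-nullness keeps the kernel positive, where [ln] is continuous. *)
Lemma cont_log_ratio i : cont_conf (log_ratio^~ i).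
Proof.
have lnG w : {for site_weight gamma w i, continuous (@ln R)}.
  by apply: continuous_ln; exact: site_weight_gt0.
apply: cont_confB.
  by apply: (cont_conf_post lnG); exact: cont_local_weight.
apply: (@cont_conf_comp _ _ (fun v => ln (site_weight gamma v i))
  (set_site i e0) id) => [N w w'|]; first exact: agree_set_site.
by apply: (cont_conf_post lnG); exact: cont_local_weight.
Qed.

Lemma agree_blank_left m N w w' : agree N w w' ->
  agree N (blank_left e0 m w) (blank_left e0 m w').
Proof. by move=> h k kN; rewrite /blank_left; case: ifP => // _; exact: h. Qed.

Lemma cont_potential : cont_conf potential.
Proof.
apply: (@cont_conf_comp _ _ (log_ratio^~ 0) (blank_left e0 0) id).
  by move=> N w w'; exact: agree_blank_left.
exact: cont_log_ratio.
Qed.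

Lemma potential_shiftn i w :
  potential (shiftn i w) = log_ratio (blank_left e0 i w) i.
Proof.
rewrite [RHS]log_ratio_shiftn; congr log_ratio; apply/funext => k.
by rewrite /blank_left /shiftn; congr (if _ then _ else _); lia.
Qed.

Lemma ext_sum_potential a b n w : ext_sum potential a b n w =
  log_ratio (blank_left e0 (- n%:Z) (upd w a)) 0
  - log_ratio (blank_left e0 (- n%:Z) (upd w b)) 0.
Proof.
(* The last [n] shifts look from a positive site with everything to its left blanked, including site
   0, the only place where the two configurations may differ. *)
rewrite /ext_sum -addSn big_split_ord /= [X in _ + X]big1 ?addr0; last first.
  move=> j _; rewrite !potential_shiftn; apply/eqP; rewrite subr_eq0; apply/eqP.
  congr log_ratio; apply/funext => k; rewrite /blank_left /upd.
  by case: ifP => // kj; case: eqP => //; lia.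
rewrite sumrB; set L := sites (- n%:Z) n.+1.
(* The remaining shifts, from [-n] to 0, telescope in the kernel of the interval [L]. *)
have S v : \sum_(j < n.+1) potential (shiftn ((j : nat)%:Z - n%:Z) v) =
    ln (G L (blank_left e0 (- n%:Z) v)) - ln (G L (blank_left e0 1 v)).
  rewrite (_ : blank_left e0 1 v =
      blank (- n%:Z) n.+1 (blank_left e0 (- n%:Z) v)).
    rewrite ln_weight_blank; last by move=> j jn; rewrite in_sites; lia.
    apply: eq_bigr => j _; rewrite potential_shiftn addrC; congr log_ratio.
    apply/funext => k; rewrite /blank_left /blank /merge in_sites.
    by do ?[case: ifPn => ?] => //; lia.
  apply/funext => k; rewrite /blank_left /blank /merge in_sites.
  by do ?[case: ifPn => ?] => //; lia.
rewrite !S.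
have L0 : 0 \in L by rewrite in_sites; lia.
(* Both log-ratios of the goal are expanded in the kernel of [L]. Once site 0 is erased, the
   configurations for [a] and [b] coincide, so all terms but two cancel on each side. *)
rewrite -!(ln_weight_set_site (L := L))//.
have -> : blank_left e0 1 (upd w b) = blank_left e0 1 (upd w a).
  apply/funext => k; rewrite /blank_left /upd; case: ifP => // k1.
  by case: eqP => //; lia.
have -> : set_site 0 e0 (blank_left e0 (- n%:Z) (upd w b)) =
          set_site 0 e0 (blank_left e0 (- n%:Z) (upd w a)).
  by apply/funext => k; rewrite !set_siteE /blank_left /upd; case: eqP.
by lra.
Qed.

(** Blanking to the left of [-n] changes nothing on [[-N, N]] once [N <= n]; uniform continuity of
    the log-ratio makes the convergence uniform. *)
Lemma extensible_potential : extensible potential.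
Proof.
move=> a b; exists (fun w => log_ratio (upd w a) 0 - log_ratio (upd w b) 0).
move=> eps eps0; have e2 : 0 < eps / 2 by rewrite divr_gt0.
have [N hN] := cont_conf_unif (cont_log_ratio 0) e2.
have h n v : (N <= n)%N ->
    `|log_ratio (blank_left e0 (- n%:Z) v) 0 - log_ratio v 0| < eps / 2.
  move=> Nn; apply: hN => k kN; rewrite /blank_left; case: ifP => //; lia.
exists N => n Nn w; rewrite ext_sum_potential.
move: (h n (upd w a) Nn) (h n (upd w b) Nn); rewrite !ltr_norml.
by move=> /andP[? ?] /andP[? ?]; apply/andP; split; lra.
Qed.

End potential.
(** * Weak Gibbs estimates *)

Section blocks.
Context {E : finType} (e0 : E).
Implicit Types (w v : conf E).

(** Because of [absz k], the negative sites above [-n] receive a mirrored copy of the word; only the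
    values on [[0, n)] matter. *)
Definition block_conf n (a : {ffun 'I_n -> E}) : conf E :=
  fun k => if (insub (absz k) : option 'I_n) is Some i then a i else e0.

Lemma block_confE n (a : {ffun 'I_n -> E}) (i : 'I_n) :
  block_conf a (i : nat)%:Z = a i.
Proof. by rewrite /block_conf /= valK. Qed.

Lemma cyl_cylinder_on n (a : {ffun 'I_n -> E}) :
  cyl a = cylinder_on (sites 0 n) (block_conf a).
Proof.
apply/seteqP; split => w /= h.
  move=> k; rewrite in_sites => /andP[k0 kn].
  have kn' : (absz k < n)%N by lia.
  rewrite (_ : k = (Ordinal kn' : nat)%:Z); last by rewrite /=; lia.
  by rewrite block_confE h.
by move=> i; rewrite h ?block_confE// in_sites; have := ltn_ord i; lia.
Qed.

Definition block_of n w : {ffun 'I_n -> E} := [ffun i : 'I_n => w (i : nat)%:Z].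

Lemma cyl_block_of n w : cyl (block_of n w) w.
Proof. by move=> i; rewrite ffunE. Qed.

Lemma cyl_eq_block n (a : {ffun 'I_n -> E}) w : cyl a w -> a = block_of n w.
Proof. by move=> h; apply/ffunP => i; rewrite ffunE h. Qed.

Lemma cyl_merge n (a : {ffun 'I_n -> E}) w :
  cyl a (merge (sites 0 n) (block_conf a) w).
Proof. by rewrite cyl_cylinder_on => k kn; rewrite /merge kn. Qed.

(** Passes from patterns on a set of integers, the index of the kernels, to words of length [n], the
    index of the cylinders in entropy and pressure. *)
Lemma sum_blocks (V : nmodType) n (F : {ffun sites 0 n -> E} -> V) :
  \sum_(xi : {ffun sites 0 n -> E}) F xi =
  \sum_(a : {ffun 'I_n -> E}) F (Defs.restr (sites 0 n) (block_conf a)).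
Proof.
pose h (a : {ffun 'I_n -> E}) := Defs.restr (sites 0 n) (block_conf a).
pose k xi := block_of n (Defs.patch (sites 0 n) xi (fun=> e0)).
rewrite (reindex h)//=; apply/onW_bij/(@Bijective _ _ h k) => [a|xi].
  apply/ffunP => i; rewrite ffunE /h patch_restr /merge in_sites.
  by rewrite block_confE; have := ltn_ord i; case: ifP => //; lia.
rewrite -[RHS](restr_patch _ (fun=> e0)).
apply/ffunP => -[s hs]; rewrite !ffunE /=.
have := hs; rewrite in_sites => /andP[s0 sn].
have sn' : (absz s < n)%N by lia.
rewrite (_ : s = (Ordinal sn' : nat)%:Z); last by rewrite /=; lia.
by rewrite block_confE ffunE.
Qed.

End blocks.

(** * Comparison of kernels, Birkhoff sums and partition functions *)

Section thermodynamics.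
Context {R : realType} {E : finType} (e0 : E) (gamma : spec_type R E).
Hypothesis gammaG : gibbsian gamma.
Hypothesis gammaS : forall (w : conf E) i,
  site_weight gamma w i = site_weight gamma (shiftn i w) 0.
Context (delta : nat -> R).
Hypothesis deltaP : forall N (w w' : conf E), agree N w w' ->
  `|log_ratio e0 gamma w' 0 - log_ratio e0 gamma w 0| <= delta N.
Implicit Types (w v : conf E).

Local Notation G n := (local_weight gamma (sites 0 n)).
Local Notation phi := (potential e0 gamma).
Local Notation S := (birkhoff phi).
Local Notation D n := (\sum_(i < n) delta i).

Definition log_partition (psi : conf E -> R) n : R :=
  ln (\sum_(a : {ffun 'I_n -> E}) expR (sup (birkhoff psi n @` cyl a))).

(** In the telescoped sum the [j]-th term has [e0] on [[0, j)], in the Birkhoff sum on all sites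
    below [j]. Seen from [j], the two configurations agree on [[-j, j]], which costs [delta j]. *)
Lemma weight_birkhoff n w :
  `|ln (G n w) - ln (G n (blank e0 0 n w)) - S n w| <= D n.
Proof.
rewrite (ln_weight_blank e0 gammaG); last by move=> j jn; rewrite in_sites; lia.
rewrite -sumrB (le_trans (ler_norm_sum _ _ _))//; apply: ler_sum => j _.
rewrite add0r (log_ratio_shiftn e0 gammaS) /potential; apply: deltaP => k kj.
rewrite /blank /blank_left /shiftn /merge in_sites.
by do ?[case: ifPn => ?] => //; lia.
Qed.

(** The [j]-th term sees [w] only from site [j] on, and agreement reaches up to [n - 1]: a window of
    radius [n - 1 - j], hence the reversed order of summation. *)
Lemma birkhoff_variation n (a : {ffun 'I_n -> E}) w w' : cyl a w -> cyl a w' ->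
  `|S n w' - S n w| <= D n.
Proof.
rewrite (cyl_cylinder_on e0) => aw aw'.
rewrite -sumrB (le_trans (ler_norm_sum _ _ _))//.
rewrite [leRHS](reindex_inj rev_ord_inj) /=; apply: ler_sum => j _.
rewrite /potential; apply: deltaP => k kj; rewrite /blank_left /shiftn.
have := ltn_ord j.
by case: ifPn => // ? ?; rewrite aw ?aw'// in_sites; lia.
Qed.

Lemma sup_birkhoff n (a : {ffun 'I_n -> E}) w : cyl a w ->
  S n w <= sup (S n @` cyl a) <= S n w + D n.
Proof.
move=> aw.
have ub : ubound (S n @` cyl a) (S n w + D n).
  move=> _ [v av <-]; have := birkhoff_variation aw av.
  by rewrite ler_norml => /andP[_]; lra.
apply/andP; split.
  by apply: ub_le_sup; [exists (S n w + D n)|exists w].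
by apply: ge_sup => //; exists (S n w), w.
Qed.

Lemma sum_weight n w :
  \sum_(a : {ffun 'I_n -> E}) G n (merge (sites 0 n) (block_conf e0 a) w) = 1.
Proof.
have [[_ _ h _] _ _] := gammaG.
rewrite -(h (sites 0 n) w) (sum_blocks e0); apply: eq_bigr => a _.
by rewrite (spec_weightE gammaG) patch_restr.
Qed.

(** With [[0, n)] blanked, [g] is the same for all words. Each supremum is the logarithm of a kernel
    value over [g] up to [D n + D n], and the kernel values sum to 1, so the partition function is
    comparable to [1 / g]. *)
Lemma log_partition_weight n w :
  `|ln (G n (blank e0 0 n w)) + log_partition phi n| <= D n + D n.
Proof.
set g := G n (blank e0 0 n w); have g0 : 0 < g by exact: local_weight_gt0.
pose v (a : {ffun 'I_n -> E}) := merge (sites 0 n) (block_conf e0 a) w.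
have vb a : blank e0 0 n (v a) = blank e0 0 n w.
  by apply/funext => k; rewrite /blank /v /merge; case: (k \in _).
have G0 a : 0 < G n (v a) by exact: local_weight_gt0.
have sE a : ln (G n (v a)) - ln g - (D n + D n) <= sup (S n @` cyl a)
            <= ln (G n (v a)) - ln g + (D n + D n).
  have := weight_birkhoff n (v a); rewrite vb -/g ler_norml => /andP[h1 h2].
  have /andP[h3 h4] := sup_birkhoff (cyl_merge e0 a w).
  by rewrite -/(v a) in h3 h4; apply/andP; split; lra.
have eE a c : expR (ln (G n (v a)) - ln g + c) = G n (v a) * (expR c / g).
  by rewrite !expRD expRN !lnK ?posrE// mulrAC mulrA.
have sum1 c : \sum_a G n (v a) * (expR c / g) = expR (c - ln g).
  by rewrite -mulr_suml sum_weight mul1r expRD expRN lnK ?posrE.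
have lb : expR (- (D n + D n) - ln g) <=
    \sum_(a : {ffun 'I_n -> E}) expR (sup (S n @` cyl a)).
  rewrite -sum1; apply: ler_sum => a _.
  by rewrite -eE ler_expR; case/andP: (sE a).
have ub : \sum_(a : {ffun 'I_n -> E}) expR (sup (S n @` cyl a)) <=
    expR ((D n + D n) - ln g).
  rewrite -sum1; apply: ler_sum => a _.
  by rewrite -eE ler_expR; case/andP: (sE a).
have Z0 := lt_le_trans (expR_gt0 _) lb.
rewrite ler_norml; apply/andP; split.
  have : - (D n + D n) - ln g <= log_partition phi n.
    by rewrite -[leLHS]expRK ler_ln ?posrE ?expR_gt0.
  by lra.
have : log_partition phi n <= (D n + D n) - ln g.
  by rewrite -[leRHS]expRK ler_ln ?posrE ?expR_gt0.
by lra.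
Qed.

Lemma weak_gibbs n w :
  `|ln (G n w) - S n w + log_partition phi n| <= D n *+ 3.
Proof.
have := weight_birkhoff n w; have := log_partition_weight n w.
rewrite !ler_norml => /andP[? ?] /andP[? ?]; apply/andP; split; lra.
Qed.

Context (mu : probability (Omega e0) R).
Hypothesis muG : is_gibbs_for gamma mu.
Hypothesis muS : shift_invariant mu.

Lemma cont_cyl n (a : {ffun 'I_n -> E}) : cont_conf (\1_(cyl a) : conf E -> R).
Proof. by rewrite (cyl_cylinder_on e0); exact: cont_cylinder_on. Qed.

(** By the DLR equation the measure of the cylinder is a mean of kernel values over boundary
    conditions. Three [D n] come from [weak_gibbs], the fourth from moving the Birkhoff sum to
    [w]. *)
Lemma measure_cyl_bound n (a : {ffun 'I_n -> E}) w : cyl a w ->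
  `|ln (fine (mu (cyl a))) - S n w + log_partition phi n| <= D n *+ 4.
Proof.
move=> aw; set P := log_partition phi n.
have wg v : expR (S n w - P - D n *+ 4) <=
    G n (merge (sites 0 n) (block_conf e0 a) v) <= expR (S n w - P + D n *+ 4).
  set x := merge _ _ _; have x0 : 0 < G n x by exact: local_weight_gt0.
  have := weak_gibbs n x; rewrite -/P.
  have := birkhoff_variation aw (cyl_merge e0 a v); rewrite -/x.
  rewrite !ler_norml => /andP[? ?] /andP[? ?].
  rewrite -[G n x]lnK ?posrE// !ler_expR; apply/andP; split; lra.
have E1 : fine (mu (cyl a)) =
    mean mu (fun v => G n (merge (sites 0 n) (block_conf e0 a) v)).
  rewrite -mean_indic; last exact: cont_cyl.
  by rewrite (cyl_cylinder_on e0) (mean_cylinder_onE gammaG muG).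
have cG : cont_conf (fun v => G n (merge (sites 0 n) (block_conf e0 a) v)).
  exact: cont_weight_merge.
have lb : expR (S n w - P - D n *+ 4) <= fine (mu (cyl a)).
  rewrite E1 -[leLHS](mean_cst mu); apply: mean_le => //.
    exact: cont_conf_cst.
  by move=> v; case/andP: (wg v).
have ub : fine (mu (cyl a)) <= expR (S n w - P + D n *+ 4).
  rewrite E1 -[leRHS](mean_cst mu); apply: mean_le => //.
    exact: cont_conf_cst.
  by move=> v; case/andP: (wg v).
have m0 := lt_le_trans (expR_gt0 _) lb.
have {}lb : S n w - P - D n *+ 4 <= ln (fine (mu (cyl a))).
  by rewrite -[leLHS]expRK ler_ln ?posrE ?expR_gt0.
have {}ub : ln (fine (mu (cyl a))) <= S n w - P + D n *+ 4.
  by rewrite -[leRHS]expRK ler_ln ?posrE ?expR_gt0.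
by rewrite ler_norml; apply/andP; split; lra.
Qed.

Lemma mean_birkhoff (psi : conf E -> R) n : cont_conf psi ->
  mean mu (birkhoff psi n) = n%:R * mean mu psi.
Proof.
move=> cpsi.
have ms (i : nat) : mean mu (fun w => psi (shiftn i%:Z w)) = mean mu psi.
  elim: i => [|i <-].
    congr mean; apply/funext => w; congr psi; apply/funext => k.
    by rewrite /shiftn addr0.
  rewrite -[RHS](mean_shift muS); last exact: cont_conf_shiftn.
  congr mean; apply/funext => w /=.
  by congr psi; apply/funext => k; rewrite /shiftn /Defs.shift; congr (w _); lia.
rewrite /birkhoff mean_sum => [|i]; last exact: cont_conf_shiftn.
by under eq_bigr do rewrite ms; rewrite sumr_const card_ord mulr_natl.
Qed.

Lemma cont_birkhoff (psi : conf E -> R) n : cont_conf psi ->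
  cont_conf (birkhoff psi n).
Proof.
by move=> cpsi; apply: cont_conf_sum => i; exact: cont_conf_shiftn.
Qed.

Lemma entropy_pressure_bound n :
  `|block_entropy mu n + n%:R * mean mu phi - log_partition phi n| <= D n *+ 4.
Proof.
pose l (a : {ffun 'I_n -> E}) := ln (fine (mu (cyl a))).
(* The logarithm of the measure of the block of [w], as a finite sum of indicators and so
   continuous; its mean is minus the block entropy. *)
pose I w := \sum_(a : {ffun 'I_n -> E}) l a * \1_(cyl a) w.
have cI : cont_conf I.
  by apply: cont_conf_sum => a; apply: cont_confZ; exact: cont_cyl.
have cS : cont_conf (S n) by apply: cont_birkhoff; exact: cont_potential.
have IE w : I w = l (block_of n w).
  rewrite /I (bigD1 (block_of n w))//= big1 ?addr0.
    by rewrite indicE mem_set ?mulr1//; exact: cyl_block_of.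
  move=> a /eqP ab; rewrite indicE memNset ?mulr0//.
  by move=> /cyl_eq_block.
have -> : block_entropy mu n + n%:R * mean mu phi =
    mean mu (fun w => S n w - I w).
  rewrite meanB// mean_birkhoff; last exact: cont_potential.
  rewrite addrC; congr (_ - _); rewrite mean_sum => [|a]; last first.
    by apply: cont_confZ; exact: cont_cyl.
  apply: eq_bigr => a _.
  by rewrite meanZ ?mean_indic 1?mulrC//; exact: cont_cyl.
have b w : log_partition phi n - D n *+ 4 <= S n w - I w
           <= log_partition phi n + D n *+ 4.
  have := measure_cyl_bound (@cyl_block_of _ n w); rewrite -/(l _) -IE ler_norml.
  by move=> /andP[? ?]; apply/andP; split; lra.
have cSI : cont_conf (fun w => S n w - I w) by exact: cont_confB.
rewrite ler_norml; apply/andP; split.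
  have : log_partition phi n - D n *+ 4 <= mean mu (fun w => S n w - I w).
    rewrite -[leLHS](mean_cst mu); apply: mean_le => //; first exact: cont_conf_cst.
    by move=> w; case/andP: (b w).
  by lra.
have : mean mu (fun w => S n w - I w) <= log_partition phi n + D n *+ 4.
  rewrite -[leRHS](mean_cst mu); apply: mean_le => //; first exact: cont_conf_cst.
  by move=> w; case/andP: (b w).
by lra.
Qed.

End thermodynamics.
(** * Pressure *)

Lemma fekete (R : realType) (u : nat -> R) (B : R) :
  (forall m n, u (m + n)%N <= u m + u n) ->
  (forall n, - (n%:R * B) <= u n) ->
  cvgn (fun n => u n / n%:R).
Proof.
move=> su lbu.
(* The limit will be the infimum of [A]; the successor excludes the index 0, where the quotient
   divides by zero. *)
pose A := [set x | exists n : nat, x = u n.+1 / n.+1%:R].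
have lbA : lbound A (- B).
  by move=> _ [n ->]; rewrite ler_pdivlMr// mulNr mulrC.
have A0 : A !=set0 by exists (u 1%N / 1%:R), 0%N.
have infA : has_inf A by split => //; exists (- B).
have su_iter m q r : u (q * m + r)%N <= q%:R * u m + u r.
  elim: q => [|q ih]; first by rewrite mul0r add0r.
  rewrite mulSn -addnA (le_trans (su _ _))// -natr1.
  by move: ih; lra.
apply/cvg_ex; exists (inf A); apply/cvgrPdist_le => eps eps0.
have e2 : 0 < eps / 2 by rewrite divr_gt0.
have [_ [m ->] hm] := inf_adherent e2 infA.
set x := u m.+1 / m.+1%:R in hm.
pose K := `|u m.+1| + \sum_(r < m.+1) `|u r|.
have K0 : 0 <= K by rewrite addr_ge0// sumr_ge0.
(* Euclidean division of [n] by [m.+1]: the quotient contributes [n * x] up to the absolute value of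
   [u m.+1], the remainder takes finitely many values, and [K] covers both. *)
have ub n : u n <= n%:R * x + K.
  have rm : (n %% m.+1 < m.+1)%N by rewrite ltn_mod.
  have h1 := su_iter m.+1 (n %/ m.+1)%N (n %% m.+1)%N.
  rewrite -divn_eq in h1.
  have h2 : u (n %% m.+1)%N <= \sum_(r < m.+1) `|u r|.
    rewrite (le_trans (ler_norm _))// (bigD1 (Ordinal rm))//= lerDl.
    by rewrite sumr_ge0.
  have h3 : (n %/ m.+1)%:R * u m.+1 <= n%:R * x + `|u m.+1|.
    have -> : u m.+1 = m.+1%:R * x by rewrite /x mulrCA divff ?mulr1.
    rewrite [in leRHS](divn_eq n m.+1) natrD natrM normrM mulrDl -mulrA -addrA lerDl.
    rewrite (@ger0_norm _ m.+1%:R)//.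
    have := ler_norm (- x); rewrite normrN.
    have : (n %% m.+1)%:R <= m.+1%:R :> R by rewrite ler_nat ltnW.
    have : 0 <= (n %% m.+1)%:R :> R by [].
    have := normr_ge0 x; nra.
  by rewrite /K; lra.
have /cvgrPdist_lt/(_ _ e2)[M _ hM] : (fun n => K * n.+1%:R^-1) @ \oo --> (0 : R).
  by rewrite -[X in _ --> X](mulr0 K); apply: cvgMr; exact: cvg_harmonic.
exists M.+1 => // n /= Mn.
have {hM} := hM n.-1; rewrite /= prednK; last exact: leq_ltn_trans Mn.
move=> /(_ ltac:(lia)); rewrite sub0r normrN => /(le_lt_trans (ler_norm _)) hK.
have n0 : (0 < n)%N by exact: leq_ltn_trans Mn.
have n0R : 0 < n%:R :> R by rewrite ltr0n.
have h1 : inf A <= u n / n%:R.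
  by apply: ge_inf; [exists (- B)|exists n.-1; rewrite prednK].
have h2 : u n / n%:R <= x + K / n%:R.
  by rewrite ler_pdivrMr// mulrDl divfK ?gt_eqF// [x * _]mulrC; exact: ub.
by rewrite ler_norml; apply/andP; split; lra.
Qed.

(** * Subadditivity of the logarithm of the partition function *)

Section pressure.
Context {R : realType} {E : finType} (e0 : E).
Implicit Types (psi : conf E -> R).

Lemma birkhoffD psi m n w :
  birkhoff psi (m + n) w = birkhoff psi m w + birkhoff psi n (shiftn m%:Z w).
Proof.
rewrite /birkhoff big_split_ord /=; congr (_ + _); apply: eq_bigr => i _.
by congr psi; apply/funext => k; rewrite /shiftn; congr (w _); lia.
Qed.

Lemma birkhoff_bound psi B n w : (forall v, `|psi v| <= B) ->
  `|birkhoff psi n w| <= n%:R * B.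
Proof.
move=> hB; rewrite (le_trans (ler_norm_sum _ _ _))//.
by rewrite (le_trans (ler_sum _ (fun i _ => hB _)))// sumr_const card_ord mulr_natl.
Qed.

Lemma birkhoff_le_sup psi B n (a : {ffun 'I_n -> E}) w :
  (forall v, `|psi v| <= B) -> cyl a w ->
  birkhoff psi n w <= sup (birkhoff psi n @` cyl a).
Proof.
move=> hB aw; apply: ub_le_sup; last by exists w.
exists (n%:R * B) => _ [v _ <-].
by rewrite (le_trans (ler_norm _))// birkhoff_bound.
Qed.

Definition cat_block m n (ab : {ffun 'I_m -> E} * {ffun 'I_n -> E}) :
    {ffun 'I_(m + n) -> E} :=
  [ffun i => match fintype.split i with inl j => ab.1 j | inr k => ab.2 k end].

Lemma cat_block_bij m n : bijective (@cat_block m n).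
Proof.
exists (fun c : {ffun 'I_(m + n) -> E} =>
  ([ffun j => c (lshift n j)], [ffun k => c (rshift m k)])) => [[a b]|c].
  congr pair; apply/ffunP => i; rewrite !ffunE.
    by rewrite (unsplitK (inl i)).
  by rewrite (unsplitK (inr i)).
apply/ffunP => i; rewrite ffunE /=.
by case: splitP => j ij; rewrite ffunE; congr (c _); apply: val_inj.
Qed.

Lemma partition_gt0 psi n :
  0 < \sum_(a : {ffun 'I_n -> E}) expR (sup (birkhoff psi n @` cyl a)).
Proof.
rewrite (bigD1 [ffun=> e0])//=; apply: ltr_pwDl; first exact: expR_gt0.
by apply: sumr_ge0 => a _; exact: expR_ge0.
Qed.

(** Words of length [m + n] are pairs of words. The supremum of the split Birkhoff sum is at most
    the sum of the two suprema, and the double sum of exponentials factors. *)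
Lemma log_partition_subadditive psi m n : cont_conf psi ->
  log_partition psi (m + n) <= log_partition psi m + log_partition psi n.
Proof.
move=> /(bounded_cont_conf (e0 := e0))[B hB].
pose Z k := \sum_(a : {ffun 'I_k -> E}) expR (sup (birkhoff psi k @` cyl a)).
have Z0 k : 0 < Z k by exact: partition_gt0.
rewrite /log_partition -!/(Z _) -lnM ?posrE// ler_ln ?posrE ?mulr_gt0//.
rewrite {1}/Z (reindex _ (onW_bij _ (cat_block_bij m n))) /= mulr_suml.
under [leRHS]eq_bigr do rewrite mulr_sumr.
rewrite pair_big /=; apply: ler_sum => -[a b] _ /=; rewrite -expRD ler_expR.
apply: ge_sup.
  pose w := block_conf e0 (cat_block (a, b)).
  by exists (birkhoff psi (m + n) w), w => // i; exact: block_confE.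
move=> _ [w cw <-]; rewrite birkhoffD lerD//; apply: birkhoff_le_sup hB _ => i.
  have := cw (lshift n i); rewrite /= => ->.
  by rewrite ffunE (unsplitK (inl i)).
have := cw (rshift m i); rewrite ffunE (unsplitK (inr i)) /= => <-.
by rewrite /shiftn; congr (w _); lia.
Qed.

(** Fekete's lemma; for the linear lower bound only the word constantly equal to [e0] is kept in the
    partition function. *)
Lemma pressure_cvg psi : cont_conf psi ->
  cvgn (fun n => log_partition psi n / n%:R).
Proof.
move=> cpsi; have [B hB] := bounded_cont_conf (e0 := e0) cpsi.
apply: (@fekete _ _ B) => [m n|n]; first exact: log_partition_subadditive.
rewrite -[leLHS]expRK ler_ln ?posrE ?expR_gt0 ?partition_gt0//.
rewrite (bigD1 [ffun=> e0])//= ler_wpDr//.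
  by apply: sumr_ge0 => a _; exact: expR_ge0.
rewrite ler_expR.
apply: (le_trans _ (@birkhoff_le_sup psi B n _ (fun=> e0) hB _)).
  by rewrite lerNl (le_trans (ler_norm _))// normrN birkhoff_bound.
by move=> i; rewrite ffunE.
Qed.

End pressure.

Theorem theoremB (R : realType) (E : finType) (e0 : E)
  (mu : probability (Omega e0) R) :
  shift_invariant mu ->
  (exists gamma : spec_type R E, gibbsian gamma /\ is_gibbs_for gamma mu) ->
  exists phi : conf E -> R,
    [/\ cont_conf phi, extensible phi & equilibrium_state phi mu].
Proof.
move=> muS [gamma [gammaG muG]].
have gammaS := site_weight_shiftn gammaG muG muS.
have cphi := cont_potential e0 gammaG.
exists (potential e0 gamma); split => //; first exact: extensible_potential.
split => //; rewrite /entropy /pressure.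
have [delta delta0 deltaP] :=
  cont_conf_modulus (e0 := e0) (cont_log_ratio e0 gammaG 0).
have bound := entropy_pressure_bound gammaG gammaS deltaP muG muS.
set m := mean mu _ in bound *.
set P := log_partition _ in bound *.
(* [limn] is meaningful only for a convergent sequence; subadditivity supplies the convergence. *)
have Pcvg : (fun n => P n / n%:R) @ \oo --> limn (fun n => P n / n%:R).
  by have := pressure_cvg e0 cphi.
rewrite -[RHS]/(limn (fun n => P n / n%:R)); set p := limn _ in Pcvg *.
suff Hcvg : (fun n => block_entropy mu n / n%:R) @ \oo --> p - m.
  by rewrite (cvg_lim _ Hcvg)//; exact: subrK.
(* Starting at index 1 makes the division by [n] legitimate. *)
rewrite -cvg_shiftS /=.
pose err n := (block_entropy mu n.+1 + n.+1%:R * m - P n.+1) / n.+1%:R.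
have errE n : block_entropy mu n.+1 / n.+1%:R = err n + (P n.+1 / n.+1%:R - m).
  have := pnatr_eq0 R n.+1; rewrite /err; move: (n.+1%:R) => k k0.
  by field; rewrite k0.
rewrite (funext errE) -(add0r (p - m)); apply: cvgD; last first.
  by apply: cvgB; [rewrite (cvg_shiftS (fun n => P n / n%:R))|exact: cvg_cst].
(* The bound on the error per site is four times a Cesaro mean of [delta], which vanishes in the
   limit because [delta] does. *)
have hD : (fun n => 4 * arithmetic_mean delta n) @ \oo --> (0 : R).
  by rewrite -[X in _ --> X](mulr0 4); apply: cvgMr; exact: cesaro.
apply/norm_cvg0P; apply: (squeeze_cvgr _ (cvg_cst 0) hD).
apply: nearW => n; rewrite normr_ge0 /= /err normrM normfV normr_nat.
rewrite /arithmetic_mean /series /= big_mkord mulrCA [leRHS]mulrC ler_wpM2r//.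
by rewrite [leRHS]mulr_natl; exact: bound.
Qed.
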